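(* Let $\mathcal I$ be a proper free ideal on $\mathbb N_0$ and let $\mathbf u=(u_n)_{n\in\mathbb N_0}$ be a $T$-sequence in an abelian group $G$. Then, algebraically (i.e., as subgroups of $\mathrm{Hom}(G,\mathbb T)$), $$(G,T^{\mathcal I}_{\mathbf u})^\wedge = s^{\mathcal I}_{\mathbf u}(G^\wedge).$$
   Context: $\mathbb N_0=\{0,1,2,\dots\}$, $\mathbb T=\mathbb R/\mathbb Z$ with its usual topology. An ideal $\mathcal I$ on $\mathbb N_0$ is a nonempty family of subsets of $\mathbb N_0$ closed under taking subsets and finite unions; it is free if it contains all finite subsets of $\mathbb N_0$, and proper if $\mathcal I\neq\mathcal P(\mathbb N_0)$. A sequence $(x_n)$ in a topological space $\mathcal I$-converges to $x$ if $\{n\in\mathbb N_0: x_n\notin U\}\in\mathcal I$ for every neighborhood $U$ of $x$. A sequence $\mathbf u$ in an abelian group $G$ is a $T$-sequence (resp., $T^{\mathcal I}$-sequence) if there is a Hausdorff group topology on $G$ in which $\mathbf u$ converges (resp., $\mathcal I$-converges) to $0$. For $\mathcal I$ free every $T$-sequence is a $T^{\mathcal I}$-sequence. For a $T^{\mathcal I}$-sequence $\mathbf u$, $T^{\mathcal I}_{\mathbf u}$ denotes the finest Hausdorff group topology on $G$ in which $\mathbf u$ $\mathcal I$-converges to $0$ (it exists: it is the supremum of all Hausdorff group topologies with this property). For a topological abelian group $(G,\tau)$, $(G,\tau)^\wedge$ is the group of continuous homomorphisms $(G,\tau)\to\mathbb T$. Here $G^\wedge$ without topology specified is $\mathrm{Hom}(G,\mathbb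 T)$ (the compact dual of the discrete group $G$), and $s^{\mathcal I}_{\mathbf u}(G^\wedge)=\{\chi\in\mathrm{Hom}(G,\mathbb T): \chi(u_n)\ \mathcal I\text{-converges to }0\text{ in }\mathbb T\}$. *)

(* Defs.v *)
From HB Require Import structures.
From mathcomp Require Import all_boot all_order all_algebra.
From mathcomp Require Import generic_quotient ring_quotient.
From mathcomp Require Import all_classical all_reals all_analysis.

Set Implicit Arguments.
Unset Strict Implicit.
Unset Printing Implicit Defensive.

Import GRing.Theory Num.Theory numFieldTopology.Exports.

Local Open Scope classical_set_scope.
Local Open Scope ring_scope.

Definition set_ideal (I : set_system nat) : Prop :=
  [/\ I !=set0,
      forall A B, A `<=` B -> I B -> I A &
      forall A B, I A -> I B -> I (A `|` B)].

Definition free_set_ideal (I : set_system nat) : Prop :=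
  forall A : set nat, finite_set A -> I A.

Definition proper_set_ideal (I : set_system nat) : Prop := I <> setT.

Definition ideal_cvg (I : set_system nat) (X : topologicalType)
    (x : nat -> X) (l : X) : Prop :=
  forall U : set X, nbhs l U -> I [set n | ~ U (x n)].

Definition int_subgroup (R : realType) : zmodClosed R :=
  GRing.ZmodClosed.clone R Num.int_num_subdef _.

(* The circle group [R / Z], with the quotient group structure and the quotient
   topology. *)
Definition circle (R : realType) : Type :=
  quotient_topology (Quotient.quot (int_subgroup R)).

Section CircleStructure.
Variable R : realType.
Local Notation Z := (int_subgroup R).

HB.instance Definition _ := Topological.on (circle R).
HB.instance Definition _ := GRing.isZmodule.Build (circle R)
  (@Quotient.addqA R Z) (@Quotient.addqC R Z)
  (@Quotient.add0q R Z) (@Quotient.addNq R Z).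

End CircleStructure.

(* A topology on the carrier of [G] is a [Topological] class record, as in the
   library's [sup_topology]; [Topological.Pack tau] is the space [(G, tau)]. *)
Section GroupTopologies.
Variable G : zmodType.
Implicit Types tau sigma : Topological G.

Definition hausdorff_group_topology tau : Prop :=
  let X : topologicalType := Topological.Pack tau in
  [/\ hausdorff_space X,
      continuous (fun p : X * X => (p.1 : G) + (p.2 : G) : X) &
      continuous (fun x : X => - (x : G) : X)].

Definition finer_topology tau sigma : Prop :=
  @open (Topological.Pack sigma) `<=` @open (Topological.Pack tau).

Definition T_sequence (u : nat -> G) : Prop :=
  exists2 tau, hausdorff_group_topology tau &
    u @ \oo --> ((0 : G) : Topological.Pack tau).

Definition TI_topologies (I : set_system nat) (u : nat -> G) :
    set (Topological G) :=
  [set tau | hausdorff_group_topology tau /\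
    ideal_cvg I (u : nat -> Topological.Pack tau) (0 : G)].

Definition finest_TI_topology (I : set_system nat) (u : nat -> G)
    tau : Prop :=
  TI_topologies I u tau /\
  forall sigma, TI_topologies I u sigma -> finer_topology tau sigma.

(* The finest element of [TI_topologies I u].  The open sets are determined by
   [finest_TI_topology]; the discrete topology is a dummy value, used only when
   no finest element exists. *)
Definition TI_topology (I : set_system nat) (u : nat -> G) : Topological G :=
  xget (Topological.class (discrete_topology G) : {classic Topological G})
       (finest_TI_topology I u).

End GroupTopologies.

Section Duals.
Variables (R : realType) (G : zmodType).

Definition topological_dual (tau : Topological G) :
    set {additive G -> circle R} :=
  [set chi : {additive G -> circle R} |
    continuous (chi : Topological.Pack tau -> circle R)].

Definition sI_subgroup (I : set_system nat) (u : nat -> G) :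
    set {additive G -> circle R} :=
  [set chi : {additive G -> circle R} | ideal_cvg I (fun n => chi (u n)) 0].

End Duals.

(* Main.v *)
(* The supremum of all topologies in [TI_topologies I u] is again one of them:
   I-convergence is convergence along the filter dual to I, so it passes to
   suprema.  Hence [TI_topology I u] is the finest such topology, and every
   character continuous for it maps [u] to an I-null sequence.  Conversely, if
   chi(u_n) I-converges to 0, then the supremum of [TI_topology I u] and the
   initial topology of chi is still in [TI_topologies I u], so [TI_topology I u] is
   finer than it, and chi is continuous for [TI_topology I u]. *)
Require Import Defs.
From mathcomp Require Import all_boot all_order all_algebra.
From mathcomp Require Import generic_quotient ring_quotient.
From mathcomp Require Import all_classical all_reals all_analysis.

Set Implicit Arguments.
Unset Strict Implicit.
Unset Printing Implicit Defensive.

Import GRing.Theory numFieldNormedType.Exports.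

Local Open Scope classical_set_scope.
Local Open Scope ring_scope.
Local Open Scope quotient_scope.

Section CircleGroup.
Variable R : realType.
Local Notation pi := (\pi_(circle R) : R -> circle R).

Lemma pi_circleD : {morph pi : x y / x + y >-> x + y}.
Proof. exact: Quotient.pi_add. Qed.

Lemma pi_circleN : {morph pi : x / - x >-> - x}.
Proof. exact: Quotient.pi_opp. Qed.

(* The saturation of [U] is the union of the translates of [U] by integers. *)
Lemma pi_circle_open (U : set R) : open U -> open (pi @` U).
Proof.
move=> oU; rewrite /open /= /quotient_open.
have -> : \pi_(circle R) @^-1` (pi @` U) =
    \bigcup_(k in [set k : R | pi k = 0]) ((fun x => x - k) @^-1` U).
  apply/seteqP; split=> [x [y Uy yx]|x [k /= k0 Uxk]].
    exists (x - y) => /=; last by rewrite subKr.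
    by rewrite pi_circleD pi_circleN yx subrr.
  by exists (x - k) => //; rewrite pi_circleD pi_circleN k0 subr0.
apply: bigcup_open => k _; apply: open_comp => // x _.
by apply: cvgB; [exact: cvg_id|exact: cvg_cst].
Qed.

Lemma pi_circle_nbhs (x : R) (U : set R) : nbhs x U -> nbhs (pi x) (pi @` U).
Proof.
rewrite nbhsE => -[V [oV Vx] VU]; apply: (filterS (image_subset _ VU)).
by apply: open_nbhs_nbhs; split; [exact: pi_circle_open|exists x].
Qed.

(** A product of quotient maps need not be a quotient map, so continuity does not simply descend
    from [R]. Openness of the projection repairs this: neighbourhoods of representatives project to
    neighbourhoods in the circle. *)
Lemma circle_add_continuous :
  continuous (fun p : circle R * circle R => p.1 + p.2).
Proof.
move=> [a b] W /=; rewrite -[a]reprK -[b]reprK -pi_circleD => nW.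
have /= := @add_continuous R^o (repr a, repr b) _ (pi_continuous nW).
case=> -[A B] /= [nA nB] AB.
exists (pi @` A, pi @` B); first by split; exact: pi_circle_nbhs.
move=> [_ _] /= [[x Ax <-] [y By <-]]; rewrite -pi_circleD.
exact: (AB (x, y)).
Qed.

Lemma circle_opp_continuous : continuous (fun x : circle R => - x).
Proof.
move=> a W /=; rewrite -[a]reprK -pi_circleN => nW.
have nA := @opp_continuous R^o (repr a) _ (pi_continuous nW).
apply: filterS (pi_circle_nbhs nA) => _ [x Ax <-].
by rewrite /= -pi_circleN.
Qed.

End CircleGroup.

Section GroupTopologies.
Variable G : zmodType.
Implicit Types tau sigma : Topological G.

(** Separation is left out so that the initial topology of a character qualifies: it cannot separate
    points of the kernel. *)
Definition group_topology tau : Prop :=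
  let X : topologicalType := Topological.Pack tau in
  continuous (fun p : X * X => (p.1 : G) + (p.2 : G) : X) /\
  continuous (fun x : X => - (x : G) : X).

Lemma finer_topology_cvg tau sigma (x : G) : finer_topology tau sigma ->
  nbhs (x : Topological.Pack tau) --> (x : Topological.Pack sigma).
Proof.
move=> ts A; rewrite !nbhsE => -[U [oU Ux] UA].
by exists U => //; split=> //; exact: ts.
Qed.

Lemma finer_hausdorff tau sigma : finer_topology tau sigma ->
  hausdorff_space (Topological.Pack sigma) ->
  hausdorff_space (Topological.Pack tau).
Proof.
move=> ts hs p q pq; apply: hs => A B nA nB.
apply: pq; first exact: (finer_topology_cvg ts nA).
exact: (finer_topology_cvg ts nB).
Qed.

Section Supremum.
Context {J : Type} (Tc : J -> Topological G).

Definition sup_top : Topological G := Topological.class (sup_topology Tc).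

Lemma sup_top_finer j : finer_topology sup_top (Tc j).
Proof.
move=> U oU; rewrite openE => x Ux.
(* The neighbourhood filter of [x] in the supremum converges to [x] there, hence also in [Tc j]. *)
have /cvg_sup /(_ j) := @cvg_id _ (nbhs (x : Topological.Pack sup_top)).
by apply; exact: open_nbhs_nbhs.
Qed.

(** Convergence to a point of the supremum is tested in each [Tc j]; the neighbourhoods found there
    are also neighbourhoods in the supremum. *)
Lemma sup_group_topology : (forall j, group_topology (Tc j)) ->
  group_topology sup_top.
Proof.
have fin j x : nbhs (x : Topological.Pack sup_top) -->
    (x : Topological.Pack (Tc j)).
  exact/finer_topology_cvg/sup_top_finer.
move=> gT; split.
  move=> [a b]; apply/(@cvg_sup _ _ Tc) => j A nA.
  have [[B C] /= [nB nC] BC] := (gT j).1 (a, b) A nA.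
  by exists (B, C) => //; split; exact: (fin j).
move=> a; apply/(@cvg_sup _ _ Tc).
  exact: (@fmap_filter _ _ _ (nbhs (a : Topological.Pack sup_top))).
move=> j A nA.
exact: (fin _ _ _ ((gT j).2 a A nA)).
Qed.

End Supremum.

(** Continuity into the initial topology is tested after composing with [f], and additivity moves
    the operation into [M]. *)
Lemma initial_group_topology (M : PreTopologicalZmodule.type)
    (f : {additive G -> M}) :
  continuous (fun p : M * M => p.1 + p.2) -> continuous (fun x : M => - x) ->
  group_topology (Topological.class (initial_topology f)).
Proof.
move=> addc oppc.
have fc : continuous (f : initial_topology f -> M) by exact: initial_continuous.
split.
  apply: (@continuous_comp_initial G
    (initial_topology f * initial_topology f)%type).
  move=> [a b] A /=; rewrite raddfD => nA.
  have [[B C] /= [nB nC] BC] := addc (f a, f b) A nA.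
  exists (f @^-1` B, f @^-1` C); first by split; exact: fc.
  by move=> [x y] /= [Bx Cy]; rewrite raddfD; exact: (BC (f x, f y)).
apply: (@continuous_comp_initial G (initial_topology f) M f
  (fun x : G => - x)).
move=> a A /=; rewrite raddfN => nA.
have := fc a _ (oppc (f a) A nA).
by apply: (@filterS _ (nbhs (a : initial_topology f))) => x /=; rewrite raddfN.
Qed.

Section IdealConvergence.
Variable I : set_system nat.
Hypothesis idI : set_ideal I.

Definition dual_filter : set_system nat := [set A | I (~` A)].

Lemma dual_filterP : Filter dual_filter.
Proof.
case: idI => -[A IA] subI UI; split; rewrite /dual_filter /=.
- by rewrite setCT; exact: subI IA.
- by move=> P Q IP IQ; rewrite /= setCI; exact: UI.
- by move=> P Q PQ; apply: subI; exact: subsetC.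
Qed.

Lemma ideal_cvg_sup {J : Type} (Tc : J -> Topological G) (u : nat -> G)
    (x : G) :
  (forall j, ideal_cvg I (u : nat -> Topological.Pack (Tc j)) x) ->
  ideal_cvg I (u : nat -> Topological.Pack (sup_top Tc)) x.
Proof.
move=> cvu; have FF := dual_filterP.
(* Unfolding [dual_filter] turns this convergence into [ideal_cvg] itself. *)
have : u @ dual_filter --> (x : sup_topology Tc) by exact/cvg_sup.
exact.
Qed.

Lemma ideal_cvg_initial (X : topologicalType) (f : G -> X) (u : nat -> G)
    (x : G) :
  ideal_cvg I (f \o u) (f x) -> ideal_cvg I (u : nat -> initial_topology f) x.
Proof.
have [_ subI _] := idI => cvfu U; rewrite nbhsE => -[_ [[A oA <-] Ax] AU].
(* Indices where [u] leaves [U] are among those where [f \o u] leaves [A]. *)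
apply: subI (cvfu A _); last exact: open_nbhs_nbhs.
by move=> n nU /AU /nU.
Qed.

(** A topology finer than a Hausdorff one is Hausdorff, so [Tc j0] alone provides separation. *)
Lemma sup_TI_topologies {J : Type} (Tc : J -> Topological G) (u : nat -> G)
    (j0 : J) : hausdorff_space (Topological.Pack (Tc j0)) ->
  (forall j, group_topology (Tc j)) ->
  (forall j, ideal_cvg I (u : nat -> Topological.Pack (Tc j)) (0 : G)) ->
  TI_topologies I u (sup_top Tc).
Proof.
move=> h0 gT cvu; have [addc oppc] := sup_group_topology gT.
split; last exact: ideal_cvg_sup.
split=> //; exact: (finer_hausdorff (@sup_top_finer _ Tc j0) h0).
Qed.

Lemma TI_topology_finest (u : nat -> G) : TI_topologies I u !=set0 ->
  finest_TI_topology I u (TI_topology I u).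
Proof.
move=> [tau0 TI0]; apply: (@xgetPex {classic Topological G}).
(* The family of all admissible topologies, indexed by themselves; [tau0] serves as its Hausdorff
   member. *)
pose Tc (j : {tau | TI_topologies I u tau}) := projT1 j.
exists (sup_top Tc); split.
  apply: (sup_TI_topologies (Tc := Tc) (j0 := exist _ tau0 TI0)).
  - by have [[]] := TI0.
  - by move=> [tau [[]]].
  - by move=> [tau []].
by move=> tau TItau; exact: (@sup_top_finer _ Tc (exist _ tau TItau)).
Qed.

End IdealConvergence.

Lemma T_sequence_TI (I : set_system nat) (u : nat -> G) :
  free_set_ideal I -> T_sequence u -> TI_topologies I u !=set0.
Proof.
move=> freeI [tau htau cvu]; exists tau; split=> // U /cvu [N _ NU].
(* Only indices below [N] can fall outside [U]. *)
apply: freeI; apply: (sub_finite_set _ (finite_II N)) => n /= nU.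
by rewrite ltnNge; apply/negP => /NU.
Qed.

End GroupTopologies.

Theorem theorem6p1 (R : realType) (I : set_system nat) (G : zmodType)
    (u : nat -> G) :
  set_ideal I -> free_set_ideal I -> proper_set_ideal I -> T_sequence u ->
  topological_dual (TI_topology I u) = sI_subgroup I u
    :> set {additive G -> circle R}.
Proof.
move=> idI freeI _ Tu.
have [[[hT addT oppT] cvu] finT] :=
  TI_topology_finest idI (T_sequence_TI freeI Tu).
apply/seteqP; split=> chi /= chiP.
  by move=> U nU; apply: (cvu (chi @^-1` U)); apply: chiP; rewrite raddf0.
pose Tc (b : bool) : Topological G :=
  if b then TI_topology I u else Topological.class (initial_topology chi).
have TIs : TI_topologies I u (sup_top Tc).
  apply: (@sup_TI_topologies _ _ idI _ Tc u true) => //.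
    case=> //; apply: initial_group_topology.
      exact: circle_add_continuous.
    exact: circle_opp_continuous.
  case=> //; apply: ideal_cvg_initial => //.
  by rewrite raddf0.
(* By maximality, it is enough that the preimage of [A] be open in the supremum, and it is already
   open in the member at [false]. *)
apply/continuousP => A oA; apply: (finT _ TIs).
by apply: (@sup_top_finer _ _ Tc false); exists A.
Qed.
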